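(* Let $n\ge2$ and let $\Gamma_n$ be the Sierpiński graph with the ''rotation-invariant'' labeling. Let $c_n$ be the number of $c$-labeled edges in a uniformly random dimer covering of $\Gamma_n$, with mean $\mu_n$ and standard deviation $\sigma_n$, and let $C_n=(c_n-\mu_n)/\sigma_n$. - For $n$ even, $C_n$ equals $-\sqrt3$ on every covering of type $t$ and equals $\frac1{\sqrt3}$ on every covering of type $g$. - For $n$ odd, $C_n$ equals $\sqrt3$ on every covering of type $f$ and equals $-\frac1{\sqrt3}$ on every covering of type $h$.
   Context: The labeled graphs $\Gamma_n$ ($n\ge2$) have three corners $L,U,R$. $\Gamma_2$ has vertices $L,U,R,X,Y,Z$ and edges: - $L$–$X$, $U$–$Y$, $R$–$Z$ (label $a$); - $L$–$Z$, $U$–$X$, $R$–$Y$ (label $b$); - $X$–$Y$, $Y$–$Z$, $Z$–$X$ (label $c$). For $n\ge3$, $\Gamma_n$ is obtained from three copies $\Gamma^L,\Gamma^U,\Gamma^R$ of $\Gamma_{n-1}$ by identifying: - corner $R$ of $\Gamma^L$ with corner $L$ of $\Gamma^R$; - corner $U$ of $\Gamma^L$ with corner $L$ of $\Gamma^U$; - corner $R$ of $\Gamma^U$ with corner $U$ of $\Gamma^R$. The corners of $\Gamma_n$ are the $L$-corner of $\Gamma^L$, the $U$-corner of $\Gamma^U$, and the $R$-corner of $\Gamma^R$. A dimer covering of $\Gamma_n$ is a matching covering every non-corner vertex, and - for $n$ odd, covering exactly $0$ or $2$ corners; - for $n$ even, covering exactly $1$ or $3$ corners. A covering is of type $f$,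 $g$, $h$, $t$ if it covers exactly $0$, $1$, $2$, $3$ corners respectively. The mean and variance of $c_n$ are $\mu_n=3^{n-1}/4$ and $\sigma_n^2=3/16$. *)

(* Defs.v *)
From HB Require Import structures.
From mathcomp Require Import all_boot all_order all_algebra.

Set Implicit Arguments.
Unset Strict Implicit.
Unset Printing Implicit Defensive.

Import Order.TTheory GRing.Theory Num.Theory.

(* These three names index both the corners of a graph and the three copies   *)
(* used to build the next one.                                                *)
Inductive corner := cL | cU | cR.
Inductive label := la | lb | lc.
Inductive vertex2 := vL | vU | vR | vX | vY | vZ.

Definition corner_to (i : corner) : 'I_3 :=
  match i with
  | cL => @Ordinal 3 0 isT | cU => @Ordinal 3 1 isT | cR => @Ordinal 3 2 isT
  end.
Definition corner_of (k : 'I_3) : corner :=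
  match val k with 0 => cL | 1 => cU | _ => cR end.
Lemma corner_toK : cancel corner_to corner_of. Proof. by case. Qed.
HB.instance Definition _ := Finite.copy corner (can_type corner_toK).

Definition label_to (l : label) : 'I_3 :=
  match l with
  | la => @Ordinal 3 0 isT | lb => @Ordinal 3 1 isT | lc => @Ordinal 3 2 isT
  end.
Definition label_of (k : 'I_3) : label :=
  match val k with 0 => la | 1 => lb | _ => lc end.
Lemma label_toK : cancel label_to label_of. Proof. by case. Qed.
HB.instance Definition _ := Finite.copy label (can_type label_toK).

Definition vertex2_to (v : vertex2) : 'I_6 :=
  match v with
  | vL => @Ordinal 6 0 isT | vU => @Ordinal 6 1 isT | vR => @Ordinal 6 2 isT
  | vX => @Ordinal 6 3 isT | vY => @Ordinal 6 4 isT | vZ => @Ordinal 6 5 isT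
  end.
Definition vertex2_of (k : 'I_6) : vertex2 :=
  match val k with 0 => vL | 1 => vU | 2 => vR | 3 => vX | 4 => vY | _ => vZ end.
Lemma vertex2_toK : cancel vertex2_to vertex2_of. Proof. by case. Qed.
HB.instance Definition _ := Finite.copy vertex2 (can_type vertex2_toK).

Record lgraph := LGraph {
  vertex : finType;
  edge : finType;
  ends : edge -> {set vertex};
  lab : edge -> label;
  corner_vertex : corner -> vertex
}.

Definition edges2 : 9.-tuple (vertex2 * vertex2 * label) :=
  [tuple (vL, vX, la); (vU, vY, la); (vR, vZ, la);
         (vL, vZ, lb); (vU, vX, lb); (vR, vY, lb);
         (vX, vY, lc); (vY, vZ, lc); (vZ, vX, lc)].

Definition Gamma2 : lgraph :=
  @LGraph vertex2 'I_9
    (fun e => [set (tnth edges2 e).1.1; (tnth edges2 e).1.2])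
    (fun e => (tnth edges2 e).2)
    (fun i => match i with cL => vL | cU => vU | cR => vR end).

Section Glue.
Variable G : lgraph.

(* (i, v) is the vertex v of the copy i of G.  Corner j of copy i is          *)
(* identified with corner i of copy j for i != j, which amounts to            *)
(*   (L, corner R) ~ (R, corner L),  (L, corner U) ~ (U, corner L),           *)
(*   (U, corner R) ~ (R, corner U).                                           *)
Definition identified : rel (corner * vertex G) := fun p q =>
  [exists i, exists j, [&& i != j, p == (i, corner_vertex G j)
                                 & q == (j, corner_vertex G i)]].

Definition glue_rel : rel (corner * vertex G) := connect identified.

Lemma identified_sym : symmetric identified.
Proof.
by move=> p q; apply/existsP/existsP => -[i /existsP[j /and3P[ij pi qj]]];
  exists j; apply/existsP; exists i; rewrite eq_sym ij qj pi.
Qed.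

Lemma glue_rel_refl : reflexive glue_rel.
Proof. exact: connect0. Qed.

Lemma glue_rel_sym : symmetric glue_rel.
Proof. exact/sym_connect_sym/identified_sym. Qed.

Lemma glue_rel_trans : transitive glue_rel.
Proof. exact: connect_trans. Qed.

Canonical glue_equiv :=
  EquivRel glue_rel glue_rel_refl glue_rel_sym glue_rel_trans.

Definition glue_vertex := {eq_quot glue_equiv}%qT.
HB.instance Definition _ := EqQuotient.on glue_vertex.
HB.instance Definition _ := Choice.on glue_vertex.
HB.instance Definition _ : isCountable glue_vertex :=
  CanIsCountable (@reprK _ glue_vertex).
HB.instance Definition _ : isFinite glue_vertex :=
  CanIsFinite (@reprK _ glue_vertex).

Definition glue_pi (p : corner * vertex G) : glue_vertex :=
  (\pi_glue_vertex p)%qT.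

Definition glue : lgraph :=
  @LGraph glue_vertex (corner * edge G)%type
    (fun e => [set glue_pi (e.1, v) | v in ends e.2])
    (fun e => lab e.2)
    (fun i => glue_pi (i, corner_vertex G i)).

End Glue.

(* Only meaningful for n >= 2. *)
Definition Gamma (n : nat) : lgraph := iter (n - 2) glue Gamma2.

Section Coverings.
Variable G : lgraph.
Implicit Types (M : {set edge G}) (v : vertex G).

Definition matching M : bool :=
  [forall v, #|[set e in M | v \in ends e]| <= 1].
Definition covers M v : bool := [exists e in M, v \in ends e].
Definition is_corner v : bool := [exists i, v == corner_vertex G i].
Definition num_corners_covered M : nat :=
  #|[set v | is_corner v & covers M v]|.
Definition num_c M : nat := #|[set e in M | lab e == lc]|.

End Coverings.

Definition dimer_coverings (n : nat) : {set {set edge (Gamma n)}} :=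
  [set M | [&& matching M,
               [forall v, ~~ is_corner v ==> covers M v]
             & num_corners_covered M \in
                 (if odd n then [:: 0; 2] else [:: 1; 3])]].

Section Types.
Variables (n : nat) (M : {set edge (Gamma n)}).

Definition type_f : bool :=
  (M \in dimer_coverings n) && (num_corners_covered M == 0).
Definition type_g : bool :=
  (M \in dimer_coverings n) && (num_corners_covered M == 1).
Definition type_h : bool :=
  (M \in dimer_coverings n) && (num_corners_covered M == 2).
Definition type_t : bool :=
  (M \in dimer_coverings n) && (num_corners_covered M == 3).

End Types.

Local Open Scope ring_scope.

Section Statistics.
Variables (R : rcfType) (n : nat).

(* Expectation for the uniform distribution on the dimer coverings. *)
Definition mean (F : {set edge (Gamma n)} -> R) : R :=
  (\sum_(M in dimer_coverings n) F M) / #|dimer_coverings n|%:R.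

Definition mu : R := mean (fun M => (num_c M)%:R).
Definition sigma : R := Num.sqrt (mean (fun M => ((num_c M)%:R - mu) ^+ 2)).
Definition normalized_c (M : {set edge (Gamma n)}) : R := ((num_c M)%:R - mu) / sigma.

End Statistics.

(* Main.v *)
(* Call M an inner covering if it is a matching covering every non-corner      *)
(* vertex. Then 4 c(M) + 2 (number of covered corners) = 3^(n-1) + 3: both     *)
(* terms are additive over the three copies, except that each of the three     *)
(* glued corners is covered in exactly one of its two copies. Writing x_i = -1 *)
(* if corner i is covered and x_i = 1 otherwise, this says                     *)
(* 4 c = 3^(n-1) + x_L + x_U + x_R.                                            *)
(* For each corner k there is an involution on inner coverings that toggles    *)
(* exactly the two corners other than k; on a glued graph, apply the one of    *)
(* the smaller graph in the two copies other than k (the corner those copies   *)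
(* share is toggled in both, hence stays covered once). Hence the x_i have     *)
(* mean 0 and are pairwise uncorrelated, so 4 c has mean 3^(n-1) and variance  *)
(* 3, and the normalized count is (x_L + x_U + x_R) / sqrt 3.                  *)

Require Import Defs.
From mathcomp Require Import all_boot all_order all_algebra.
From mathcomp Require Import zify ring lra.
Import Order.TTheory GRing.Theory Num.Theory.

Set Implicit Arguments.
Unset Strict Implicit.
Unset Printing Implicit Defensive.

(** Let k be the number of covered corners. By [c_count_law_Gamma], 4 c_n = 3^(n-1) + 3 - 2k, so c_n
    is an affine function of k and only the first two moments of 3 - 2k are needed. That quantity is
    a sum of three signs, one per corner ([imbalance_num]). The involutions of [Gamma_toggles]
    preserve the parity of k, hence act on the dimer coverings, and force the signs to be centred
    and pairwise uncorrelated: 3 - 2k has mean 0 and variance 3. Thus C_n = (3 - 2k) / sqrt 3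
    ([normalized_c_eq]), to be read off at k = 0, 1, 2, 3. The counting law and the involutions both
    come by induction along the gluing, from a finite check on [Gamma2]; the inductive step rests on
    [inner_covering_glueP]. *)

Lemma sum_corner (V : nmodType) (F : corner -> V) :
  (\sum_i F i = F cL + F cU + F cR)%R.
Proof.
rewrite (reindex_onto corner_of corner_to) => [|i _]; last exact: corner_toK.
rewrite (eq_bigl predT) => [|k]; last first.
  by apply/eqP/val_inj; case: k => [[|[|[|]]]].
by rewrite !big_ord_recl big_ord0 /= Monoid.mulm1 Monoid.mulmA.
Qed.

Lemma sum_corner_nat (F : corner -> nat) : \sum_i F i = F cL + F cU + F cR.
Proof. exact: sum_corner. Qed.

(** * Inner coverings in terms of vertex degrees *)

Section Coverings.
Variable G : lgraph.
Implicit Types (M : {set edge G}) (v : vertex G) (i j k : corner).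

Definition degree M v : nat := #|[set e in M | v \in ends e]|.

Definition inner_covering M : bool :=
  matching M && [forall v, ~~ is_corner v ==> covers M v].

Definition corner_covered M i : bool := covers M (corner_vertex G i).

Lemma covers_degree M v : covers M v = (0 < degree M v).
Proof.
rewrite card_gt0; apply/exists_inP/set0Pn => [[e eM ve]|[e]].
  by exists e; rewrite inE eM.
by rewrite inE => /andP[eM ve]; exists e.
Qed.

Lemma degree_sum M v : degree M v = \sum_(e in M) (v \in ends e).
Proof.
rewrite /degree -sum1_card -big_mkcondr /=.
by apply: eq_bigl => e; rewrite inE.
Qed.

Lemma inner_coveringP M :
  reflect ((forall v, degree M v <= 1) /\
           (forall v, ~~ is_corner v -> degree M v = 1))
          (inner_covering M).
Proof.
apply: (iffP andP) => [[/forallP d1 /forallP c]|[d1 c]]; split=> //.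
- move=> v nv; apply/eqP; rewrite eqn_leq [_ <= _]d1 /= -covers_degree.
  exact: (implyP (c v)).
- exact/forallP.
- by apply/forallP=> v; apply/implyP => /c dv; rewrite covers_degree dv.
Qed.

Lemma degree_corner M i :
  inner_covering M -> degree M (corner_vertex G i) = corner_covered M i.
Proof.
move=> /inner_coveringP[d1 _]; rewrite /corner_covered covers_degree.
by case: degree (d1 (corner_vertex G i)) => [|[|]].
Qed.

Lemma num_corners_coveredE M : injective (corner_vertex G) ->
  num_corners_covered M = \sum_i corner_covered M i.
Proof.
move=> cI; rewrite /num_corners_covered.
rewrite -big_mkcond /= sum1_card -(card_imset _ cI).
apply: eq_card => v; rewrite inE; apply/andP/imsetP.
  by move=> [/existsP[i /eqP ->] ci]; exists i.
by move=> [i ci ->]; split=> //; apply/existsP; exists i.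
Qed.

End Coverings.

(** * Inner coverings of a glued graph *)

Section Glue.
Variable G : lgraph.
Hypothesis cI : injective (corner_vertex G).
Implicit Types (M : {set edge (glue G)}) (i j k : corner) (p q : corner * vertex G).
Local Notation c := (corner_vertex G).

(** Corners being distinct, each point has at most one partner under [identified], so two
    consecutive identifications lead back to the start and the equivalence closure adds only
    equality. *)
Lemma glue_piP p q : reflect (p = q \/ identified p q) (glue_pi p == glue_pi q).
Proof.
have -> : (glue_pi p == glue_pi q) = glue_rel p q.
  by rewrite /glue_pi; apply/eqP/idP => [/eqquotP //|h]; apply/eqquotP.
apply: (iffP idP) => [/connectP[s]|[->|h]]; last first.
- exact: connect1.
- exact: connect0.
elim/last_ind: s q => [|s x IHs] q /=; first by move=> _ ->; left.
rewrite rcons_path last_rcons => /andP[ps hx] ->.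
case: (IHs _ ps erefl) => [->|]; first by right.
move: hx => /existsP[i /existsP[j /and3P[ij /eqP-> /eqP->]]].
case/existsP=> [i' /existsP[j' /and3P[ij' /eqP-> /eqP[eij /cI eij']]]].
by left; rewrite eij eij'.
Qed.

Lemma glue_pi_eq i (v : vertex G) k (u : vertex G) :
  (glue_pi (k, u) == glue_pi (i, v)) =
  (if k == i then u == v else (v == c k) && (u == c i)).
Proof.
apply/glue_piP/idP => [[[-> ->]|]|]; first by rewrite !eqxx.
  move=> /existsP[a /existsP[b /and3P[ab /eqP[-> ->] /eqP[-> ->]]]].
  by rewrite (negbTE ab) !eqxx.
case: eqVneq => [-> /eqP->|ki /andP[/eqP-> /eqP->]]; first by left.
by right; apply/existsP; exists k; apply/existsP; exists i; rewrite ki !eqxx.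
Qed.

Lemma glue_corner_inj : injective (corner_vertex (glue G)).
Proof.
move=> i j /eqP; rewrite /= glue_pi_eq; case: eqVneq => // _.
by case/andP=> /eqP/cI ->.
Qed.

Lemma is_corner_glue i (v : vertex G) :
  is_corner (glue_pi (i, v) : vertex (glue G)) = (v == c i).
Proof.
apply/existsP/eqP => [[k]|->]; last by exists i => /=.
rewrite /= eq_sym glue_pi_eq; case: eqVneq => [->|ki /andP[_ /eqP/cI kiE]].
  by move/eqP.
by rewrite kiE eqxx in ki.
Qed.

Lemma glue_pi_surj (w : vertex (glue G)) : exists i v, w = glue_pi (i, v).
Proof.
exists (repr (w : glue_vertex G)).1, (repr (w : glue_vertex G)).2.
by rewrite -surjective_pairing /glue_pi reprK.
Qed.

Lemma ends_glue i (v : vertex G) k (e : edge G) :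
  (glue_pi (i, v) \in @ends (glue G) (k, e)) =
  (if k == i then v \in ends e else (v == c k) && (c i \in ends e)).
Proof.
apply/imsetP/idP => /=.
  move=> [u ue /eqP]; rewrite eq_sym glue_pi_eq.
  by case: (k == i) => [/eqP<-//|/andP[-> /eqP<-]].
case: eqVneq => [-> ve|ki /andP[/eqP-> ce]]; first by exists v.
by exists (c i) => //; apply/eqP; rewrite eq_sym glue_pi_eq (negbTE ki) !eqxx.
Qed.

Definition copy_of M k : {set edge G} := [set e | (k, e) \in M].

Lemma sum_glue M (F : edge (glue G) -> nat) :
  \sum_(x in M) F x = \sum_k \sum_(e in copy_of M k) F (k, e).
Proof.
rewrite pair_big_dep /=.
by apply: eq_big => [[k e]|[k e]] //=; rewrite inE.
Qed.

(** An edge of another copy k meets the class of [(i, v)] only when v is corner k, and then it does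
    so at corner i of copy k. *)
Lemma degree_glue M i (v : vertex G) :
  degree M (glue_pi (i, v)) =
  degree (copy_of M i) v +
    \sum_(k | k != i) (v == c k) * degree (copy_of M k) (c i).
Proof.
rewrite degree_sum sum_glue (bigD1 i) //= degree_sum; congr (_ + _).
  by apply: eq_bigr => e _; rewrite ends_glue eqxx.
apply: eq_bigr => k ki; rewrite degree_sum big_distrr /=.
by apply: eq_bigr => e _; rewrite ends_glue (negbTE ki) mulnb.
Qed.

Lemma degree_glued M i j : i != j ->
  degree M (glue_pi (i, c j)) =
  degree (copy_of M i) (c j) + degree (copy_of M j) (c i).
Proof.
move=> ij; rewrite degree_glue; congr (_ + _).
rewrite (bigD1 j) /= 1?eq_sym // eqxx mul1n big1 ?addn0 // => k /andP[_ kj].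
by rewrite (inj_eq cI) eq_sym (negbTE kj).
Qed.

Lemma degree_unglued M i (v : vertex G) :
  (forall j, j != i -> v != c j) ->
  degree M (glue_pi (i, v)) = degree (copy_of M i) v.
Proof.
move=> vc; rewrite degree_glue big1 ?addn0 // => k ki.
by rewrite (negbTE (vc k ki)).
Qed.

Lemma corner_covered_glue M i :
  corner_covered M i = corner_covered (copy_of M i) i.
Proof.
rewrite /corner_covered !covers_degree /= degree_unglued // => j ji.
by rewrite (inj_eq cI) eq_sym.
Qed.

(** A glued corner is no longer a corner, so its degree, the sum of its degrees in the two copies,
    must be 1: exactly one of them covers it. All other vertices keep the degree they have in their
    own copy. *)
Lemma inner_covering_glueP M :
  reflect ((forall i, inner_covering (copy_of M i)) /\
           (forall i j, i != j -> corner_covered (copy_of M i) j =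
                                  ~~ corner_covered (copy_of M j) i))
          (inner_covering M).
Proof.
apply: (iffP idP) => [/inner_coveringP[d1 d2]|[cov x]].
  have cov i : inner_covering (copy_of M i).
    apply/inner_coveringP; split=> v => [|nv].
      by apply: leq_trans (d1 (glue_pi (i, v))); rewrite degree_glue leq_addr.
    have nvc j : v != c j by apply: contra nv => ?; apply/existsP; exists j.
    by rewrite -degree_unglued // d2 // is_corner_glue.
  split=> // i j ij.
  have := d2 (glue_pi (i, c j)); rewrite is_corner_glue (inj_eq cI) eq_sym.
  move/(_ ij); rewrite degree_glued // !degree_corner //.
  by do 2!case: corner_covered.
have key i v : degree M (glue_pi (i, v)) <= 1 /\
    (v != c i -> degree M (glue_pi (i, v)) = 1).
  (* Separate the glued vertices, where two copies contribute, from those that belong to copy i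
     alone. *)
  have [/existsP[j /andP[ji /eqP->]]|] := boolP [exists j, (j != i) && (v == c j)].
    rewrite degree_glued 1?eq_sym // !degree_corner // x 1?eq_sym //.
    by case: corner_covered.
  rewrite negb_exists => /forallP nv.
  have vc j : j != i -> v != c j by move=> ji; move: (nv j); rewrite ji.
  have /inner_coveringP[d1 d2] := cov i.
  rewrite degree_unglued //; split=> // vi; apply: d2.
  by apply/existsP => -[j vj]; case: (eqVneq j i) vj => [->|/vc]; exact/negP.
apply/inner_coveringP; split=> w; have [i [v ->]] := glue_pi_surj w.
  by case: (key i v).
by rewrite is_corner_glue; case: (key i v).
Qed.

Lemma num_c_glue M : num_c M = \sum_k num_c (copy_of M k).
Proof.
have E (H : lgraph) (N : {set edge H}) : num_c N = \sum_(e in N) (lab e == lc).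
  rewrite /num_c -sum1_card -big_mkcondr /=.
  by apply: eq_bigl => e; rewrite inE.
by rewrite E sum_glue; apply: eq_bigr => k _; rewrite E.
Qed.

End Glue.

(** * Toggling involutions and their extension to glued graphs *)

Definition toggles (G : lgraph) (k : corner) (T : {set edge G} -> {set edge G}) :=
  forall M, inner_covering M ->
  [/\ inner_covering (T M), T (T M) = M &
      forall i, corner_covered (T M) i = (i != k) (+) corner_covered M i].

Section GlueToggle.
Variables (G : lgraph) (k : corner) (T : {set edge G} -> {set edge G}).
Hypothesis cI : injective (corner_vertex G).

Definition glue_toggle (M : {set edge (glue G)}) : {set edge (glue G)} :=
  [set x | x.2 \in if x.1 == k then copy_of M x.1 else T (copy_of M x.1)].

Lemma copy_glue_toggle M i :
  copy_of (glue_toggle M) i = if i == k then copy_of M i else T (copy_of M i).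
Proof. by apply/setP=> e; rewrite !inE. Qed.

Lemma glue_toggles : toggles k T -> toggles k glue_toggle.
Proof.
move=> TT M /(inner_covering_glueP cI)[cov x].
have covT i : inner_covering (copy_of (glue_toggle M) i).
  by rewrite copy_glue_toggle; case: ifP => // _; case: (TT _ (cov i)).
(* The condition for a flip is symmetric in i and j, so a glued corner is flipped in both of its
   copies or in neither and stays covered exactly once. *)
have cc i j : corner_covered (copy_of (glue_toggle M) i) j =
    (i != k) && (j != k) (+) corner_covered (copy_of M i) j.
  by rewrite copy_glue_toggle; case: eqP => // _; case: (TT _ (cov i)).
split.
- apply/(inner_covering_glueP cI); split=> // i j ij.
  by rewrite !cc x // andbC addbN.
- apply/setP => -[i e]; rewrite inE /= !copy_glue_toggle.
  case: eqP => _; first by rewrite inE.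
  by case: (TT _ (cov i)) => _ -> _; rewrite inE.
- by move=> i; rewrite !corner_covered_glue // cc andbb.
Qed.

End GlueToggle.

(** * The linear relation between c-edges and covered corners *)

Definition c_count_law (G : lgraph) (w : nat) := forall M : {set edge G},
  inner_covering M -> 4 * num_c M + 2 * \sum_i corner_covered M i = w + 3.

(** Adding the laws of the three copies gives 3w + 9 on the right. On the left the three glued
    corners, each covered once, account for 2 * 3 = 6, which leaves 3w + 3 for the outer corners and
    the c-edges. *)
Lemma c_count_law_glue (G : lgraph) (w : nat) :
  injective (corner_vertex G) -> c_count_law G w -> c_count_law (glue G) (3 * w).
Proof.
move=> cI law M /(inner_covering_glueP cI)[cov x].
have := (law _ (cov cL), law _ (cov cU), law _ (cov cR)).
rewrite num_c_glue !sum_corner_nat !corner_covered_glue // => -[[]].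
rewrite (x cL cU) // (x cL cR) // (x cU cR) //.
by do 6!case: corner_covered => /=; lia.
Qed.

(** * The base graph, by computation on bit vectors *)

(** Edge sets are replaced by Boolean lists of length 9, on which degrees and coverings evaluate, so
    that statements on [Gamma2] reduce to 512 closed cases. *)
Definition bits_of (M : {set edge Gamma2}) : seq bool :=
  mkseq (fun i => (inord i : 'I_9) \in M) 9.

Definition set_of_bits (s : seq bool) : {set edge Gamma2} :=
  [set e : 'I_9 | nth false s e].

Lemma bits_ofK : cancel bits_of set_of_bits.
Proof. by move=> M; apply/setP => e; rewrite inE nth_mkseq // inord_val. Qed.

Lemma set_of_bitsK s : size s = 9 -> bits_of (set_of_bits s) = s.
Proof.
move=> s9; apply: (@eq_from_nth _ false); first by rewrite size_mkseq.
by move=> i; rewrite size_mkseq => i9; rewrite nth_mkseq // inE inordK.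
Qed.

(* Edges are numbered as in edges2. *)
Definition incident (v : vertex2) : seq nat :=
  match v with
  | vL => [:: 0; 3] | vU => [:: 1; 4] | vR => [:: 2; 5]
  | vX => [:: 0; 4; 6; 8] | vY => [:: 1; 5; 6; 7] | vZ => [:: 2; 3; 7; 8]
  end.

Definition bits_degree (s : seq bool) (v : vertex2) : nat :=
  sumn [seq (nth false s i : nat) | i <- incident v].

Lemma degree_bits s v : degree (set_of_bits s) v = bits_degree s v.
Proof.
rewrite degree_sum big_mkcond /= !big_ord_recl big_ord0 !inE /=.
by case: v; rewrite /bits_degree /= !if_same !add0n; do !case: ifP.
Qed.

Lemma num_c_bits s :
  num_c (set_of_bits s) = nth false s 6 + nth false s 7 + nth false s 8.
Proof.
rewrite /num_c -sum1_card (eq_bigl (fun e : 'I_9 => nth false s e && (6 <= e))).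
  rewrite big_mkcond /= !big_ord_recl big_ord0 /= !andbF !andbT.
  by do 3!case: nth.
move=> e; rewrite !inE; congr (_ && _).
by case: e => [[|[|[|[|[|[|[|[|[|?]]]]]]]]]].
Qed.

Definition corner2 (i : corner) : vertex2 :=
  match i with cL => vL | cU => vU | cR => vR end.

(** The computable form of [inner_covering], see [inner_covering_bits]. *)
Definition bits_covering (s : seq bool) : bool :=
  [&& bits_degree s vL <= 1, bits_degree s vU <= 1, bits_degree s vR <= 1,
      bits_degree s vX == 1, bits_degree s vY == 1 & bits_degree s vZ == 1].

Lemma is_corner2 (v : vertex Gamma2) :
  is_corner v = (v \in [:: vL; vU; vR]).
Proof.
apply/existsP/idP => [[[] /eqP->] //|].
by rewrite !inE => /or3P[]/eqP->; [exists cL | exists cU | exists cR].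
Qed.

Lemma inner_covering_bits s : inner_covering (set_of_bits s) = bits_covering s.
Proof.
apply/inner_coveringP/idP => [[d1 d2]|].
  have d1' v : bits_degree s v <= 1 by rewrite -degree_bits d1.
  have d2' v : v \notin [:: vL; vU; vR] -> bits_degree s v == 1.
    by move=> nv; rewrite -degree_bits d2 // is_corner2.
  by rewrite /bits_covering !d1' !d2'.
move=> /and5P[dL dU dR /eqP dX /andP[/eqP dY /eqP dZ]].
by split=> v; rewrite degree_bits ?is_corner2; case: v => //; rewrite ?dX ?dY ?dZ.
Qed.

Lemma corner_covered_bits s i :
  corner_covered (set_of_bits s) i = (0 < bits_degree s (corner2 i)).
Proof. by rewrite /corner_covered covers_degree -degree_bits; case: i. Qed.

Lemma c_count_law2 : c_count_law Gamma2 3.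
Proof.
move=> M; rewrite -(bits_ofK M) inner_covering_bits num_c_bits sum_corner_nat.
rewrite !corner_covered_bits; have: size (bits_of M) = 9 by rewrite size_mkseq.
move: (bits_of M).
case=> [|b0 [|b1 [|b2 [|b3 [|b4 [|b5 [|b6 [|b7 [|b8 [|? ?]]]]]]]]]] // _.
by move: b0 b1 b2 b3 b4 b5 b6 b7 b8; do 9!case.
Qed.

Definition edge_bits (A : seq nat) : seq bool := mkseq (fun i => i \in A) 9.

(* A pairing of the eight inner coverings of Gamma2 such that paired coverings
   differ at exactly the two corners other than k.  The three tables are
   rotations of one another. *)
Definition toggle_table (k : corner) : seq (seq nat * seq nat) :=
  match k with
  | cR => [:: ([:: 0; 1; 2], [:: 2; 6]); ([:: 3; 4; 5], [:: 5; 8]);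
              ([:: 0; 7], [:: 4; 7]); ([:: 3; 6], [:: 1; 8])]
  | cL => [:: ([:: 0; 1; 2], [:: 0; 7]); ([:: 3; 4; 5], [:: 3; 6]);
              ([:: 1; 8], [:: 5; 8]); ([:: 4; 7], [:: 2; 6])]
  | cU => [:: ([:: 0; 1; 2], [:: 1; 8]); ([:: 3; 4; 5], [:: 4; 7]);
              ([:: 2; 6], [:: 3; 6]); ([:: 5; 8], [:: 0; 7])]
  end.

(** Swaps the two members of each pair of the table; a list outside the table is left as it is. *)
Definition bits_toggle (k : corner) (s : seq bool) : seq bool :=
  foldr (fun p r => if s == edge_bits p.1 then edge_bits p.2
                    else if s == edge_bits p.2 then edge_bits p.1 else r)
    s (toggle_table k).

Definition toggle2 (k : corner) (M : {set edge Gamma2}) : {set edge Gamma2} :=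
  set_of_bits (bits_toggle k (bits_of M)).

Lemma bits_toggleP k s : size s = 9 -> bits_covering s ->
  [/\ size (bits_toggle k s) = 9, bits_covering (bits_toggle k s),
      bits_toggle k (bits_toggle k s) = s &
      forall i, (0 < bits_degree (bits_toggle k s) (corner2 i)) =
                (i != k) (+) (0 < bits_degree s (corner2 i))].
Proof.
case: s => [|b0 [|b1 [|b2 [|b3 [|b4 [|b5 [|b6 [|b7 [|b8 [|? ?]]]]]]]]]] // _.
move: b0 b1 b2 b3 b4 b5 b6 b7 b8.
by do 9!case=> //; case: k => _; split=> //; case.
Qed.

Lemma toggles2 k : toggles k (toggle2 k).
Proof.
move=> M; rewrite -(bits_ofK M) inner_covering_bits => cov.
have s9 : size (bits_of M) = 9 by rewrite size_mkseq.
have [s9' cov' K x] := bits_toggleP k s9 cov.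
rewrite /toggle2 bits_ofK; split.
- by rewrite inner_covering_bits.
- by rewrite set_of_bitsK // K bits_ofK.
- by move=> i; rewrite -[in RHS](bits_ofK M) !corner_covered_bits.
Qed.

(** * Induction along the gluing, and the action on dimer coverings *)

Lemma corner_vertex2_inj : injective (corner_vertex Gamma2).
Proof. by case; case. Qed.

Lemma iter_glue_corner_inj m : injective (corner_vertex (iter m glue Gamma2)).
Proof.
elim: m => [|m IHm]; first exact: corner_vertex2_inj.
exact: glue_corner_inj.
Qed.

Lemma Gamma_corner_inj n : injective (corner_vertex (Gamma n)).
Proof. exact: iter_glue_corner_inj. Qed.

Lemma Gamma_toggles n k :
  exists T : {set edge (Gamma n)} -> {set edge (Gamma n)}, toggles k T.
Proof.
rewrite /Gamma; elim: (n - 2) => [|m [T TT]].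
  by exists (toggle2 k); exact: toggles2.
by exists (glue_toggle k T); apply: glue_toggles => //; exact: iter_glue_corner_inj.
Qed.

Lemma c_count_law_Gamma n : 2 <= n -> c_count_law (Gamma n) (3 ^ n.-1).
Proof.
move=> n2; rewrite -(subnK n2) /Gamma addnK addn2 /=; elim: (n - 2) => [|m IHm].
  exact: c_count_law2.
by rewrite expnS; apply: c_count_law_glue => //; exact: iter_glue_corner_inj.
Qed.

Lemma dimer_coveringsE n (M : {set edge (Gamma n)}) :
  (M \in dimer_coverings n) =
  inner_covering M && (\sum_i corner_covered M i \in
                         (if odd n then [:: 0; 2] else [:: 1; 3])).
Proof. by rewrite inE andbA num_corners_coveredE //; exact: Gamma_corner_inj. Qed.

(** Flipping two corners preserves the parity of the number of covered ones, and among 0, ..., 3 the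
    admissible values are exactly those of one parity. *)
Lemma toggles_dimer n k (T : {set edge (Gamma n)} -> {set edge (Gamma n)}) M :
  toggles k T -> M \in dimer_coverings n -> T M \in dimer_coverings n.
Proof.
move=> TT; rewrite !dimer_coveringsE => /andP[cov].
have [-> _ x] := TT _ cov; rewrite !sum_corner_nat !x.
by case: k {T TT x} => /=; do 3!case: corner_covered; case: odd.
Qed.

Lemma sum_toggle n (V : nmodType) (F : {set edge (Gamma n)} -> V) k
    (T : {set edge (Gamma n)} -> {set edge (Gamma n)}) :
  toggles k T ->
  (\sum_(M in dimer_coverings n) F M = \sum_(M in dimer_coverings n) F (T M))%R.
Proof.
move=> TT.
have TK M : M \in dimer_coverings n -> T (T M) = M.
  by rewrite dimer_coveringsE => /andP[/TT[]].
rewrite (reindex_onto T T) //; apply: eq_bigl => M.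
apply/andP/idP => [[TM /eqP <-]|MD]; first exact: toggles_dimer TT TM.
by rewrite (toggles_dimer TT MD) TK.
Qed.

(** * Mean and variance from corner signs *)

Local Open Scope ring_scope.

Section Moments.
Variables (R : rcfType) (n : nat).
Implicit Types M : {set edge (Gamma n)}.
Local Notation D := (dimer_coverings n).

Definition sign_covered M i : R := (-1) ^+ corner_covered M i.

(** The toggle attached to any corner k other than i permutes the dimer coverings and flips the sign
    at i, so the sum equals its opposite. *)
Lemma sum_sign_covered i : \sum_(M in D) sign_covered M i = 0.
Proof.
have [k ik] : exists k, i != k by case: i; [exists cR | exists cR | exists cL].
have [T TT] := Gamma_toggles n k.
set S := LHS; suff: S = - S by lra.
rewrite {1}/S (sum_toggle _ TT) -sumrN; apply: eq_bigr => M.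
rewrite dimer_coveringsE => /andP[/TT[_ _ x] _].
by rewrite /sign_covered x ik /=; case: corner_covered; rewrite ?opprK.
Qed.

(* The toggle fixing corner i flips the sign at j but not the one at i. *)
Lemma sum_sign_covered_mul i j : i != j ->
  \sum_(M in D) sign_covered M i * sign_covered M j = 0.
Proof.
move=> ij; have [T TT] := Gamma_toggles n i.
set S := LHS; suff: S = - S by lra.
rewrite {1}/S (sum_toggle _ TT) -sumrN; apply: eq_bigr => M.
rewrite dimer_coveringsE => /andP[/TT[_ _ x] _].
rewrite /sign_covered !x eqxx eq_sym ij /= -mulrN.
by congr (_ * _); case: (corner_covered M j); rewrite ?opprK.
Qed.

Definition imbalance M : R := \sum_i sign_covered M i.

Lemma sum_imbalance : \sum_(M in D) imbalance M = 0.
Proof. by rewrite exchange_big big1 // => i _; exact: sum_sign_covered. Qed.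

Lemma sum_imbalance_sqr : \sum_(M in D) imbalance M ^+ 2 = 3 * #|D|%:R.
Proof.
pose s M i := sign_covered M i.
(* Expand the square: each sign squares to 1, which gives the 3, and the cross terms vanish after
   summation. *)
transitivity (\sum_(M in D) (3 + 2 * (s M cL * s M cU) + 2 * (s M cL * s M cR)
                               + 2 * (s M cU * s M cR))).
  apply: eq_bigr => M _; rewrite /imbalance sum_corner /s /sign_covered.
  by do 3!case: corner_covered; rewrite ?expr0 ?expr1; ring.
rewrite !big_split /= -!mulr_sumr !sum_sign_covered_mul // !mulr0 !addr0.
by rewrite !sumr_const; ring.
Qed.

Lemma imbalance_num M : imbalance M = 3 - 2 * (num_corners_covered M)%:R.
Proof.
rewrite num_corners_coveredE; last exact: Gamma_corner_inj.
rewrite /imbalance sum_corner sum_corner_nat /sign_covered.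
by do 3!case: corner_covered => /=; rewrite ?expr0 ?expr1; ring.
Qed.

Hypothesis n_ge2 : (2 <= n)%N.

Lemma num_c_imbalance M : M \in D ->
  (num_c M)%:R = (3 ^+ n.-1 + imbalance M) / 4 :> R.
Proof.
rewrite dimer_coveringsE => /andP[cov _].
have := c_count_law_Gamma n_ge2 cov.
rewrite -num_corners_coveredE; last exact: Gamma_corner_inj.
move/(congr1 (fun m => m%:R : R)); rewrite imbalance_num.
rewrite (natrD _ (4 * _)) (natrD _ (3 ^ _)) !natrM natrX.
lra.
Qed.

(** The covering M witnesses that the sample space is nonempty, so that its cardinal can be
    cancelled. *)
Lemma mu_eq M : M \in D -> mu R n = 3 ^+ n.-1 / 4.
Proof.
move=> MD; have D0 : #|D|%:R != 0 :> R.
  by rewrite pnatr_eq0 -lt0n card_gt0; apply/set0Pn; exists M.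
rewrite /mu /mean (eq_bigr _ num_c_imbalance) -mulr_suml big_split /=.
by rewrite sum_imbalance sumr_const addr0 -mulr_natr; field.
Qed.

Lemma sigma_eq M : M \in D -> sigma R n = Num.sqrt 3 / 4.
Proof.
move=> MD; have D0 : #|D|%:R != 0 :> R.
  by rewrite pnatr_eq0 -lt0n card_gt0; apply/set0Pn; exists M.
rewrite /sigma /mean (eq_bigr (fun N => imbalance N ^+ 2 / 16)); last first.
  by move=> N ND; rewrite num_c_imbalance // (mu_eq MD); field.
rewrite -mulr_suml sum_imbalance_sqr.
have -> : 3 * #|D|%:R / 16 / #|D|%:R = 3 * (4^-1) ^+ 2 :> R by field.
by rewrite sqrtrM // sqrtr_sqr ger0_norm // invr_ge0.
Qed.

Lemma normalized_c_eq M : M \in D -> normalized_c R M =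
  (3 - 2 * (num_corners_covered M)%:R) / Num.sqrt 3.
Proof.
move=> MD; rewrite /normalized_c num_c_imbalance // (mu_eq MD) (sigma_eq MD).
by rewrite imbalance_num; field; rewrite sqrtr_eq0 -ltNge.
Qed.

End Moments.

Theorem theorem5p5 (R : rcfType) (n : nat) (hn : (2 <= n)%N) :
  (~~ odd n ->
     (forall M : {set edge (Gamma n)}, type_t M -> normalized_c R M = - Num.sqrt 3) /\
     (forall M : {set edge (Gamma n)}, type_g M -> normalized_c R M = 1 / Num.sqrt 3)) /\
  (odd n ->
     (forall M : {set edge (Gamma n)}, type_f M -> normalized_c R M = Num.sqrt 3) /\
     (forall M : {set edge (Gamma n)}, type_h M -> normalized_c R M = - (1 / Num.sqrt 3))).
Proof.
have s0 : Num.sqrt 3 != 0 :> R by rewrite sqrtr_eq0 -ltNge.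
have s2 : Num.sqrt 3 * Num.sqrt 3 = 3 :> R by rewrite -expr2 sqr_sqrtr.
split=> _; split=> M /andP[MD /eqP num]; rewrite normalized_c_eq // num;
  (* The numerator 3 - 2k is -3, 1, 3, -1 for types t, g, f, h; multiplying both sides by sqrt 3
     clears the denominators. *)
  apply: (mulIf s0); rewrite ?mulNr !mulfVK // ?s2; ring.
Qed.
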